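(* Let $R$ be a commutative ring with identity and $M$ a finitely generated faithful multiplication $R$-module. For any submodule $N$ of $M$, the following statements are equivalent: (1) $N$ is a quasi $J$-submodule of $M$. (2) $\sqrt{(N:M)}$ is a $J$-ideal of $R$. (3) $\sqrt{(N:M)}$ is a quasi $J$-ideal of $R$. (4) $(N:M)$ is a quasi $J$-ideal of $R$.
   Context: All rings are commutative with identity and all modules are unital. $J(R)$ is the Jacobson radical of $R$. For a submodule $N$ of an $R$-module $M$, $(N:M)=\{r\in R: rM\subseteq N\}$. $M$ is faithful if $(0:M)=0$; $M$ is a multiplication module if every submodule of $M$ has the form $IM$ for some ideal $I$ of $R$. A proper submodule $P$ of $M$ is prime if $rm\in P$ ($r\in R$, $m\in M$) implies $m\in P$ or $r\in(P:M)$. $M\text{-}rad(N)$ is the intersection of all prime submodules of $M$ containing $N$ (an empty intersection being $M$). A proper submodule $N$ of $M$ is a quasi $J$-submodule if whenever $r\in R$, $m\in M$ with $rm\in N$ and $r\notin (J(R)M:M)$, then $m\in M\text{-}rad(N)$. A proper ideal $I$ of $R$ is a $J$-ideal if whenever $a,b\in R$ with $ab\in I$ and $a\notin J(R)$, then $b\in I$. A proper ideal $I$ of $R$ is a quasi $J$-ideal if its radical $\sqrt I$ is a $J$-ideal. *)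

(* Defs.v *)
From mathcomp Require Import all_boot all_algebra.
From mathcomp Require Import boolp classical_sets.

Set Implicit Arguments.
Unset Strict Implicit.
Unset Printing Implicit Defensive.

Import GRing.Theory.
Local Open Scope classical_set_scope.
Local Open Scope ring_scope.

(* Commutative rings are [comPzRingType]s, so the zero ring is included. *)

Section Submodules.
Variables (R : comPzRingType) (M : lmodType R).
Implicit Types N P : set M.

Definition is_submodule N : Prop := submod_closed (mem N).

Definition is_proper_submodule N : Prop := is_submodule N /\ N <> setT.

(* The residual (N : M). *)
Definition colon N : set R := [set r | forall m, N (r *: m)].

Definition is_prime_submodule P : Prop :=
  is_proper_submodule P /\
  forall (r : R) (m : M), P (r *: m) -> P m \/ colon P r.

(* M-rad(N); an empty intersection is [setT]. *)
Definition module_radical N : set M :=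
  \bigcap_(P in [set P | is_prime_submodule P /\ N `<=` P]) P.

End Submodules.

Section Ideals.
Variable R : comPzRingType.
Implicit Types I K : set R.

(* Ideals are the submodules of the regular module and may be improper, unlike
   the sets satisfying [idealr_closed]. *)
Definition is_ideal I : Prop := is_submodule (I : set R^o).

Definition is_proper_ideal I : Prop := is_ideal I /\ I <> setT.

Definition is_maximal_ideal I : Prop :=
  is_proper_ideal I /\
  forall K, is_proper_ideal K -> I `<=` K -> K = I.

Definition ideal_radical I : set R := [set r | exists n, I (r ^+ n.+1)].

End Ideals.

(* The intersection of all maximal ideals (the whole ring for the zero ring). *)
Definition jacobson (R : comPzRingType) : set R :=
  \bigcap_(I in [set I | is_maximal_ideal I]) I.
Arguments jacobson R : clear implicits.

(* The submodule IM: all finite sums of products a *: m with a in I, m in M. *)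
Definition ideal_smul (R : comPzRingType) (I : set R) (M : lmodType R) :
    set M :=
  [set x | exists (n : nat) (a : 'I_n -> R) (m : 'I_n -> M),
     (forall i, I (a i)) /\ x = \sum_(i < n) a i *: m i].
Arguments ideal_smul {R} I M.

Section ModuleProperties.
Variables (R : comPzRingType) (M : lmodType R).

Definition finitely_generated : Prop :=
  exists (n : nat) (g : 'I_n -> M),
    forall x : M, exists a : 'I_n -> R, x = \sum_(i < n) a i *: g i.

Definition faithful_module : Prop := colon [set (0 : M)] = [set (0 : R)].

Definition multiplication_module : Prop :=
  forall N : set M, is_submodule N ->
    exists I : set R, is_ideal I /\ N = ideal_smul I M.

End ModuleProperties.

Definition is_J_ideal (R : comPzRingType) (I : set R) : Prop :=
  is_proper_ideal I /\
  forall a b : R, I (a * b) -> ~ jacobson R a -> I b.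

Definition is_quasi_J_ideal (R : comPzRingType) (I : set R) : Prop :=
  is_proper_ideal I /\ is_J_ideal (ideal_radical I).

Definition is_quasi_J_submodule (R : comPzRingType) (M : lmodType R)
    (N : set M) : Prop :=
  is_proper_submodule N /\
  forall (r : R) (m : M),
    N (r *: m) -> ~ colon (ideal_smul (jacobson R) M) r ->
    module_radical N m.

Arguments finitely_generated {R} M.
Arguments faithful_module {R} M.
Arguments multiplication_module {R} M.

(* Main.v *)
Require Import Defs.
From mathcomp Require Import all_boot all_algebra.
From mathcomp Require Import boolp classical_sets.
From mathcomp Require Import ring.

(* For a prime ideal P, the residual of PM is P (a Nakayama-type argument), so
   that PM is a prime submodule when M is a multiplication module.  As the
   radical of (N : M) is the intersection of the primes containing it, this
   shows that r M lies in M-rad(N) only if r lies in that radical; applied to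
   maximal ideals, it shows (J(R)M : M) = J(R).  To pass from elements of M to
   elements of R, write the cyclic submodule generated by m as IM. *)

Set Implicit Arguments.
Unset Strict Implicit.
Unset Printing Implicit Defensive.

Import GRing.Theory.
Local Open Scope classical_set_scope.
Local Open Scope ring_scope.

(** * Submodules, residuals and prime submodules *)

Section SubmoduleTheory.
Variables (R : comPzRingType) (M : lmodType R).
Implicit Types (N P : set M).

Lemma is_submoduleP N :
  is_submodule N <-> N 0 /\ forall a u v, N u -> N v -> N (a *: u + v).
Proof.
split=> [[N0 NZD]|[N0 NZD]].
  split; first by move: N0; rewrite inE.
  move=> a u v Nu Nv.
  by have := NZD a u v; rewrite !inE; apply.
split; first by rewrite inE.
by move=> a u v; rewrite !inE => Nu Nv; apply: NZD.
Qed.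

Lemma submodule0 N : is_submodule N -> N 0.
Proof. by case/is_submoduleP. Qed.

Lemma submoduleD N u v : is_submodule N -> N u -> N v -> N (u + v).
Proof.
by case/is_submoduleP=> _ NZD Nu Nv; rewrite -[u]scale1r; apply: NZD.
Qed.

Lemma submoduleZ N a u : is_submodule N -> N u -> N (a *: u).
Proof.
by case/is_submoduleP=> N0 NZD Nu; rewrite -[_ *: _]addr0; apply: NZD.
Qed.

Lemma cyclic_submodule (m : M) : is_submodule [set a *: m | a in setT].
Proof.
apply/is_submoduleP; split; first by exists 0 => //; rewrite scale0r.
move=> a _ _ [b _ <-] [c _ <-]; exists (a * b + c) => //.
by rewrite scalerDl scalerA.
Qed.

Lemma colon1 N : colon N 1 <-> N = setT.
Proof.
split=> [N1|-> //]; apply/seteqP; split=> // m _.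
by rewrite -[m]scale1r; apply: N1.
Qed.

Lemma prime_submoduleX P r n :
  is_prime_submodule P -> colon P (r ^+ n.+1) -> colon P r.
Proof.
case=> _ primeP; elim: n => [//|n IHn] Prn.
have [Pr|nPr] := pselect (colon P r); first by [].
apply: IHn => m; have := Prn m; rewrite exprS -scalerA.
by case/primeP.
Qed.

End SubmoduleTheory.

(** * Prime ideals, radicals of ideals and the Jacobson radical *)

Section IdealTheory.
Variable R : comPzRingType.
Implicit Types I K P : set R.

Lemma is_idealP I :
  is_ideal I <-> I 0 /\ forall a u v, I u -> I v -> I (a * u + v).
Proof. exact: (is_submoduleP (I : set R^o)). Qed.

Lemma ideal0 I : is_ideal I -> I 0.
Proof. exact: (@submodule0 R R^o). Qed.

Lemma idealD I a b : is_ideal I -> I a -> I b -> I (a + b).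
Proof. exact: (@submoduleD R R^o). Qed.

Lemma idealMl I a b : is_ideal I -> I b -> I (a * b).
Proof. exact: (@submoduleZ R R^o). Qed.

Lemma idealMr I a b : is_ideal I -> I a -> I (a * b).
Proof. by rewrite mulrC; apply: idealMl. Qed.

Lemma ideal_proper1 I : is_ideal I -> (I <> setT <-> ~ I 1).
Proof.
move=> iI; split=> [IT I1|nI1 IT]; last by apply: nI1; rewrite IT.
by apply: IT; apply/seteqP; split=> // a _; rewrite -[a]mulr1; apply: idealMl.
Qed.

Definition is_prime_ideal P : Prop :=
  [/\ is_ideal P, ~ P 1 & forall a b, P (a * b) -> P a \/ P b].

Lemma prime_idealX P a n : is_prime_ideal P -> P (a ^+ n) -> P a.
Proof.
case=> _ nP1 primeP; elim: n => [|n IHn]; first by rewrite expr0 => /nP1.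
by rewrite exprS => /primeP[].
Qed.

Lemma ideal_add_principal I c :
  is_ideal I -> is_ideal [set x | exists2 i, I i & exists a, x = i + a * c].
Proof.
move=> iI; apply/is_idealP; split.
  by exists 0; [exact: ideal0 | exists 0; rewrite mul0r addr0].
move=> a _ _ [i Ii [b ->]] [j Ij [d ->]].
exists (a * i + j); first by apply: idealD => //; apply: idealMl.
by exists (a * b + d); ring.
Qed.

(** If [a] and [b] are outside [P], then [P + (a)] and [P + (b)] each contain a power of [r]. The
    product of these powers lies in [P + (ab)], hence in [P] if [ab] does. *)
Lemma maximal_avoiding_prime P r :
  is_ideal P -> (forall n, ~ P (r ^+ n)) ->
  (forall K, is_ideal K -> P `<=` K -> (forall n, ~ K (r ^+ n)) -> K `<=` P) ->
  is_prime_ideal P.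
Proof.
move=> iP Pr maxP; split=> //; first exact: (Pr 0%N).
have meet c : ~ P c -> exists n i a, P i /\ r ^+ n = i + a * c.
  move=> nPc; apply: contrapT => nmeet; apply: nPc.
  apply: (maxP _ (ideal_add_principal c iP)).
  - by move=> i Pi; exists i => //; exists 0; rewrite mul0r addr0.
  - by move=> n [i Pi [a rn]]; apply: nmeet; exists n, i, a.
  - by exists 0; [exact: ideal0 | exists 1; rewrite mul1r add0r].
move=> a b Pab.
have [Pa|/meet[n [i [c [Pi rn]]]]] := pselect (P a); first by left.
have [Pb|/meet[k [j [d [Pj rk]]]]] := pselect (P b); first by right.
exfalso; apply: (Pr (n + k)%N); rewrite exprD rn rk.
have -> : (i + c * a) * (j + d * b) =
          (j + d * b) * i + (c * a * j + c * d * (a * b)) by ring.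
by do 2?apply: idealD => //; apply: idealMl.
Qed.

(** An ideal is proper exactly when it avoids the powers of 1. *)
Lemma maximal_ideal_prime P : is_maximal_ideal P -> is_prime_ideal P.
Proof.
case=> -[iP /(ideal_proper1 iP) nP1] maxP.
apply: (@maximal_avoiding_prime _ 1) => //.
  by move=> n; rewrite expr1n.
move=> K iK PK /(_ 0%N) nK1; rewrite (maxP K) //; split=> //.
exact/ideal_proper1.
Qed.

Lemma jacobsonX a n : jacobson R (a ^+ n) -> jacobson R a.
Proof.
move=> Jan P maxP; apply: prime_idealX (Jan P maxP).
exact: maximal_ideal_prime.
Qed.

Lemma prime_avoiding I r : is_ideal I -> (forall n, ~ I (r ^+ n)) ->
  exists P, [/\ is_prime_ideal P, I `<=` P & ~ P r].
Proof.
move=> iI Ir.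
(* Adding [I] to the candidate sets makes the empty chain admissible. *)
pose good A := is_ideal (I `|` A) /\ forall n, ~ (I `|` A) (r ^+ n).
have [F goodF totF|A [[iA Ar] maxA]] := @Zorn_bigcup R good.
  split; last first.
    by move=> n [/Ir//|[A FA An]]; apply: ((goodF A FA).2 n); right.
  apply/is_idealP; split; first by left; exact: ideal0.
  (* Since the chain is total, [u] and [v] can always be placed in [I] together with a single member
     of the chain. *)
  have closed A a u v : F A -> (I `|` A) u -> (I `|` A) v ->
      (I `|` \bigcup_(X in F) X) (a * u + v).
    move=> FA Au Av; have [iA _] := goodF A FA.
    have [] : (I `|` A) (a * u + v) by apply: idealD => //; apply: idealMl.
      by left.
    by right; exists A.
  move=> a u v [Iu|[A FA Au]] [Iv|[B FB Bv]].
  - by left; apply: idealD => //; apply: idealMl.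
  - by apply: (closed B) => //; [left|right].
  - by apply: (closed A) => //; [right|left].
  - have [AB|BA] := totF A B FA FB.
      by apply: (closed B) => //; right=> //; apply: AB.
    by apply: (closed A) => //; right=> //; apply: BA.
exists (I `|` A); split; last by rewrite -[r]expr1; apply: Ar.
  apply: (maximal_avoiding_prime iA Ar) => K iK AK Kr.
  (* As [K] contains [I], it is itself a candidate, so maximality of [A] can be applied to it. *)
  have IK : I `|` K = K by by apply: setUidr => x Ix; apply: AK; left.
  have [KA|nKA] := pselect (K `<=` A).
    by move=> x /KA; right.
  exfalso; apply: (maxA K); last by split; rewrite IK.
  by split=> // x Ax; apply: AK; right.
by move=> x; left.
Qed.

Lemma ideal_radicalE I : is_ideal I ->
  ideal_radical I = \bigcap_(P in [set P | is_prime_ideal P /\ I `<=` P]) P.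
Proof.
move=> iI; apply/seteqP; split=> [a [n Ian] P [primeP IP]|a aP].
  by apply: prime_idealX primeP (IP _ Ian).
apply: contrapT => nIa.
have [n Ian|P [primeP IP]] := prime_avoiding (r := a) iI.
  by apply: nIa; exists n; rewrite exprS; apply: idealMl.
by apply; apply: aP.
Qed.

(** The description by primes spares the binomial expansion of a power of a sum. *)
Lemma ideal_radical_ideal I : is_ideal I -> is_ideal (ideal_radical I).
Proof.
move=> iI; rewrite ideal_radicalE //; apply/is_idealP; split.
  by move=> P [[iP _ _] _]; apply: ideal0.
move=> a u v Pu Pv P PP; have [[iP _ _] _] := PP.
by apply: idealD; [|apply: idealMl => //; apply: Pu|apply: Pv].
Qed.

Lemma sub_ideal_radical I : I `<=` ideal_radical I.
Proof. by move=> a Ia; exists 0%N; rewrite expr1. Qed.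

Lemma ideal_radical1 I : ideal_radical I 1 <-> I 1.
Proof. by split=> [[n]|/sub_ideal_radical//]; rewrite expr1n. Qed.

Lemma ideal_radicalK I : ideal_radical (ideal_radical I) = ideal_radical I.
Proof.
apply/seteqP; split; last exact: sub_ideal_radical.
(* The witness is [(n+1)(k+1) - 1], as [ideal_radical] shifts exponents by one. *)
move=> a [n [k Iank]]; exists (n * k.+1 + k)%N.
by move: Iank; rewrite -exprM mulSnr addnC -addnS addnC.
Qed.

End IdealTheory.

(** * The submodules [IM], their residuals and radicals *)

Section IdealSmul.
Variables (R : comPzRingType) (M : lmodType R).
Implicit Types (I K P : set R) (N : set M).

Lemma colon_ideal N : is_submodule N -> is_ideal (colon N).
Proof.
move=> sN; apply/is_idealP; split.
  by move=> m; rewrite scale0r; apply: submodule0.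
move=> a u v Nu Nv m; rewrite scalerDl -scalerA.
by apply: submoduleD => //; apply: submoduleZ.
Qed.

Lemma mem_ideal_smul I a m : I a -> ideal_smul I M (a *: m).
Proof.
move=> Ia; exists 1%N, (fun=> a), (fun=> m); split=> //.
by rewrite big_ord1.
Qed.

Lemma ideal_smul_sub I N : is_submodule N ->
  (forall a m, I a -> N (a *: m)) -> ideal_smul I M `<=` N.
Proof.
move=> sN IN _ [n [a [m [Ia ->]]]].
elim/big_ind: _ => [|x y|i _]; [exact: submodule0|exact: submoduleD|].
exact: IN.
Qed.

Lemma ideal_smul_submodule I : is_ideal I -> is_submodule (ideal_smul I M).
Proof.
move=> iI; apply/is_submoduleP; split.
  by exists 0%N, (fun=> 0), (fun=> 0); split=> [[]//|]; rewrite big_ord0.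
move=> c _ _ [n [a [x [Ia ->]]]] [k [b [y [Ib ->]]]].
exists (n + k)%N,
  (fun i => match split i with inl j => c * a j | inr j => b j end),
  (fun i => match split i with inl j => x j | inr j => y j end).
split=> [i|]; first by case: (split i) => j //; apply: idealMl.
rewrite big_split_ord scaler_sumr /=; congr (_ + _); apply: eq_bigr => j _.
  by rewrite (unsplitK (inl j)) scalerA.
by rewrite (unsplitK (inr j)).
Qed.

Lemma ideal_smulS I K : is_ideal K -> I `<=` K ->
  ideal_smul I M `<=` ideal_smul K M.
Proof.
move=> iK IK; apply: ideal_smul_sub; first exact: ideal_smul_submodule.
by move=> a m /IK; apply: mem_ideal_smul.
Qed.

(** This trades [m] for the ideal [I] with [Rm = IM]: [m] is in [KM] once an ideal [K] contains [I],
    and [rm] in a submodule [N] gives [raM] inside [N] for each [a] in [I]. *)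
Lemma multiplication_cyclic (m : M) : multiplication_module M ->
  exists I, [/\ is_ideal I, ideal_smul I M m &
    forall a x, I a -> exists c, a *: x = c *: m].
Proof.
move=> /(_ _ (cyclic_submodule m))[I [iI mI]]; exists I; split=> //.
  by rewrite -mI; exists 1; rewrite ?scale1r.
move=> a x Ia; have : ideal_smul I M (a *: x) by apply: mem_ideal_smul.
by rewrite -mI => -[c _ <-]; exists c.
Qed.

(** If [N = IM], then [I] is contained in [(N : M)]. *)
Lemma multiplication_sub N : multiplication_module M -> is_submodule N ->
  N `<=` ideal_smul (colon N) M.
Proof.
move=> multM sN; have [I [iI NI]] := multM N sN.
rewrite {1}NI; apply: ideal_smulS; first exact: colon_ideal.
by move=> a Ia m; rewrite NI; apply: mem_ideal_smul.
Qed.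

(* Nakayama by descent: an [s] outside [P] multiplying [M] into the span of
   [k.+1] elements yields one for the first [k] of them. *)
Lemma colon_prime_smul_descent P r k (g : 'I_k -> M) s :
  faithful_module M -> is_prime_ideal P -> colon (ideal_smul P M) r ->
  ~ P r -> ~ P s ->
  ~ forall x, exists a : 'I_k -> R, s *: x = \sum_(i < k) a i *: g i.
Proof.
move=> faithM primeP rM nPr; have [iP _ mulP] := primeP.
elim: k g s => [|k IHk] g s nPs sM.
  (* With no generators left, [sM = 0], and faithfulness forces [s = 0], which lies in [P]. *)
  apply: nPs; suff -> : s = 0 by apply: ideal0.
  suff : colon [set (0 : M)] s by rewrite faithM.
  by move=> x; have [a ->] := sM x; rewrite big_ord0.
(* Elements whose multiple by [s] has coordinates in [P]. They form a submodule containing [PM],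
   hence [r] times the last generator. *)
pose NP := [set y | exists b : 'I_k.+1 -> R,
  (forall i, P (b i)) /\ s *: y = \sum_i b i *: g i].
have sNP : is_submodule NP.
  apply/is_submoduleP; split.
    exists (fun=> 0); split=> [_|]; first exact: ideal0.
    by rewrite scaler0 big1 // => i _; rewrite scale0r.
  move=> c u v [a [Pa ua]] [b [Pb vb]]; exists (fun i => c * a i + b i).
  split=> [i|]; first by apply: idealD => //; apply: idealMl.
  rewrite scalerDr scalerA mulrC -scalerA ua vb scaler_sumr -big_split /=.
  by apply: eq_bigr => i _; rewrite scalerDl scalerA.
have PMN : ideal_smul P M `<=` NP.
  apply: ideal_smul_sub sNP _ => p m Pp; have [a ma] := sM m.
  exists (fun i => p * a i); split=> [i|]; first exact: idealMr.
  rewrite scalerA mulrC -scalerA ma scaler_sumr.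
  by apply: eq_bigr => i _; rewrite scalerA.
have [b [Pb]] := PMN _ (rM (g ord_max)).
rewrite big_ord_recr /= scalerA => gb.
(* Moving the last term to the left, [t] sends the last generator into the span of the others;
   modulo [P], [t] is [sr], so it is outside [P]. *)
set t := s * r - b ord_max.
have tg : t *: g ord_max =
    \sum_(i < k) b (widen_ord (leqnSn k) i) *: g (widen_ord (leqnSn k) i).
  by rewrite scalerBl gb addrK.
have nPt : ~ P t.
  move=> Pt; have [] // : P s \/ P r.
  by apply: mulP; rewrite -[s * r](subrK (b ord_max)); apply: idealD.
apply: (IHk (g \o widen_ord (leqnSn k)) (t * s)) => [/mulP[]//|x].
have [a xa] := sM x.
(* Expand [s *: x], multiply by [t], and replace [t *: g ord_max] using [tg]. *)
exists (fun i => t * a (widen_ord (leqnSn k) i)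
                 + a ord_max * b (widen_ord (leqnSn k) i)).
rewrite -scalerA xa big_ord_recr /= scalerDr scaler_sumr.
rewrite scalerA mulrC -scalerA tg scaler_sumr -big_split /=.
by apply: eq_bigr => i _; rewrite scalerDl !scalerA.
Qed.

Lemma colon_prime_smul P r : finitely_generated M -> faithful_module M ->
  is_prime_ideal P -> colon (ideal_smul P M) r -> P r.
Proof.
move=> [k [g gM]] faithM primeP rM; apply: contrapT => nPr.
have [_ nP1 _] := primeP.
apply: (colon_prime_smul_descent (g := g) (s := 1) faithM primeP rM nPr nP1).
by move=> x; have [a ->] := gM x; exists a; rewrite scale1r.
Qed.

Lemma colon_jacobson_smul : finitely_generated M -> faithful_module M ->
  colon (ideal_smul (jacobson R) M) `<=` jacobson R.
Proof.
move=> fgM faithM r rJ P maxP; have primeP := maximal_ideal_prime maxP.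
apply: (colon_prime_smul fgM faithM primeP) => m.
apply: ideal_smulS (rJ m); first by case: primeP.
by move=> a; apply.
Qed.

(** If [rm] is in [PM] with [r] outside [P], write [Rm = IM]: then [rIM] lies in [PM], so [rI] lies
    in [P], hence so does [I], and [m] is in [PM]. *)
Lemma prime_smul_prime P :
  finitely_generated M -> faithful_module M -> multiplication_module M ->
  is_prime_ideal P -> is_prime_submodule (ideal_smul P M).
Proof.
move=> fgM faithM multM primeP; have [iP nP1 mulP] := primeP.
have sPM := ideal_smul_submodule iP.
split.
  by split=> // /colon1 /(colon_prime_smul fgM faithM primeP).
move=> r m Prm.
have [Pr|nPr] := pselect (P r); [right|left].
  by move=> x; apply: mem_ideal_smul.
have [I [iI Im cI]] := multiplication_cyclic m multM.
apply: ideal_smulS iP _ _ Im => a Ia.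
have [//|//] : P r \/ P a.
apply: mulP; apply: (colon_prime_smul fgM faithM primeP) => x.
have [c ac] := cI a x Ia.
by rewrite -scalerA ac scalerA mulrC -scalerA; apply: submoduleZ.
Qed.

(** For a prime [P] containing [(N : M)], [N] lies in [(N : M)M], hence in [PM]. So [PM] is one of
    the prime submodules defining [M-rad(N)], and [r] is in [(PM : M) = P]. *)
Lemma colon_module_radical N :
  finitely_generated M -> faithful_module M -> multiplication_module M ->
  is_submodule N -> colon (module_radical N) `<=` ideal_radical (colon N).
Proof.
move=> fgM faithM multM sN r rN.
rewrite ideal_radicalE; last exact: colon_ideal.
move=> P [primeP NP]; apply: (colon_prime_smul fgM faithM primeP) => m.
apply: rN; split; first exact: prime_smul_prime.
apply: subset_trans (multiplication_sub multM sN) _.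
by apply: ideal_smulS => //; case: primeP.
Qed.

Lemma radical_smul_sub N :
  ideal_smul (ideal_radical (colon N)) M `<=` module_radical N.
Proof.
move=> x Nx P [primeP NP]; have [[sP _] _] := primeP.
apply: ideal_smul_sub sP _ _ Nx => a m [n Nan].
by apply: (prime_submoduleX primeP (n := n)) => y; apply: NP.
Qed.

End IdealSmul.

Theorem proposition10 (R : comPzRingType) (M : lmodType R)
    (fgM : finitely_generated M) (faithM : faithful_module M)
    (multM : multiplication_module M)
    (N : set M) (subN : is_submodule N) :
  [<-> is_quasi_J_submodule N;
       is_J_ideal (ideal_radical (colon N));
       is_quasi_J_ideal (ideal_radical (colon N));
       is_quasi_J_ideal (colon N)].
Proof.
have iN := colon_ideal subN; have iradN := ideal_radical_ideal iN.
tfae.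
- case=> -[_ NT] JN; split.
    by split=> //; apply/ideal_proper1 => // /ideal_radical1 /colon1.
  move=> a b [n]; rewrite exprMn => Nab nJa.
  (* It suffices to treat [b ^+ n.+1], by showing that it sends [M] into [M-rad(N)]; (1) is then
     applied with the scalar [a ^+ n.+1]. *)
  rewrite -ideal_radicalK; exists n.
  apply: colon_module_radical => // m.
  apply: (JN (a ^+ n.+1)); first by rewrite scalerA.
  by move=> /(colon_jacobson_smul fgM faithM) /jacobsonX.
- by move=> JN; split; [case: JN | rewrite ideal_radicalK].
- case=> -[_ /(ideal_proper1 iradN) nN1]; rewrite ideal_radicalK => JN.
  by split=> //; split=> //; apply/ideal_proper1 => // /ideal_radical1.
- case=> -[_ /(ideal_proper1 iN) nN1] [_ JN]; split.
    by split=> // /colon1.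
  move=> r m Nrm nJr.
  have [I [iI Im cI]] := multiplication_cyclic m multM.
  (* It remains to see that [I] lies in the radical of [(N : M)]. For [a] in [I], [ra] is in
     [(N : M)] because [aM] lies in [Rm], and [r] is outside [J(R)]. *)
  apply: radical_smul_sub; apply: ideal_smulS iradN _ _ Im => a Ia.
  apply: (JN r); last first.
    by move=> Jr; apply: nJr => x; apply: mem_ideal_smul.
  apply: sub_ideal_radical => x; have [c ac] := cI a x Ia.
  by rewrite -scalerA ac scalerA mulrC -scalerA; apply: submoduleZ.
Qed.
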